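(* Let $(X,X^+)$ be an ordered Banach space with generating and normal cone and let $A: X \supseteq \operatorname{dom}(A) \to X$ be a resolvent positive operator. Then the following assertions are equivalent: (i) $s(A) = s_{\mathbb{R}}(A) < 0$. (ii) The operator $A: \operatorname{dom}(A) \to X$ is bijective and $-A^{-1} = \mathcal{R}(0,A)$ is positive. (iii) There exists a number $c > 0$ such that, for all $0 \le x \in \operatorname{dom}(A)$ and all $0 \le y \in X$, the inequality $-Ax \le y$ implies $\|x\| \le c\|y\|$. (iv) There exists a number $\eta > 0$ such that $\operatorname{dist}(Ax, X^+) \ge \eta \|x\|$ for all $0 \le x \in \operatorname{dom}(A)$. (v) There exists a number $\varepsilon > 0$ such that $(A+P)x \not\ge 0$ whenever $x$ is a positive non-zero vector in $\operatorname{dom}(A)$ and $P: X \to X$ is a positive linear operator of norm $\|P\| \le \varepsilon$. (vi) There exists a number $\varepsilon > 0$ such that $(A+P)x \not\ge 0$ whenever $x$ is a positive non-zero vector in $\operatorname{dom}(A)$ and $P: X \to X$ is a positive linear operator of norm $\|P\| \le \varepsilon$ and of rank $1$.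
   Context: An ordered Banach space $(X,X^+)$ is a real Banach space $X$ together with a closed convex cone $X^+$ (so $X^+ + X^+ \subseteq X^+$ and $[0,\infty)X^+ \subseteq X^+$) with $X^+ \cap (-X^+) = \{0\}$. One writes $x \le y$ iff $y - x \in X^+$; elements of $X^+$ are called positive vectors. The cone is generating if $X^+ - X^+ = X$, and normal if there is $C>0$ with $\|x\| \le C\|y\|$ whenever $0 \le x \le y$. A bounded linear operator $T$ on $X$ is positive ($T\ge 0$) if $TX^+ \subseteq X^+$. Spectral notions for a closed operator $A$ on $X$ (spectrum $\sigma(A)$, resolvent set $\rho(A)$, resolvent $\mathcal{R}(\lambda,A) = (\lambda - A)^{-1}$) always refer to the canonical extension of $A$ to a complexification $X_{\mathbb{C}}$ of $X$. A linear operator $A: X \supseteq \operatorname{dom}(A) \to X$ is resolvent positive if there is $\omega \in \mathbb{R}$ such that $(\omega,\infty) \subseteq \rho(A)$ and $\mathcal{R}(\lambda,A)$ is positive for each $\lambda \in (\omega,\infty)$. The spectral bound is $s(A) := \sup\{\operatorname{Re}\lambda : \lambda \in \sigma(A)\}$ and the real spectral bound is $s_{\mathbb{R}}(A) := \sup(\sigma(A) \cap \mathbb{R})$, both in $[-\infty,\infty]$ with $\sup \emptyset = -\infty$. For $S \subseteq X$, $\operatorname{dist}(x,S) := \inf\{\|x-y\| : y \in S\}$. *)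

(* Defs.v *)
From HB Require Import structures.
From mathcomp Require Import all_boot all_order all_algebra.
From mathcomp Require Import all_classical all_reals all_analysis.
From mathcomp Require Import complex.
Set Implicit Arguments.
Unset Strict Implicit.
Unset Printing Implicit Defensive.
Import Order.TTheory GRing.Theory Num.Theory numFieldNormedType.Exports.

Local Open Scope classical_set_scope.
Local Open Scope ring_scope.
Local Open Scope complex_scope.

(* The pair (x, y) stands for x + i y. All norms that make the complexification
   of a Banach space a complex Banach space extending it induce the product
   topology, so only this topology is recorded. *)
Definition complexification (X : Type) : Type := (X * X)%type.

HB.instance Definition _ (X : zmodType) :=
  GRing.Zmodule.copy (complexification X) (X * X)%type.
HB.instance Definition _ (X : topologicalType) :=
  Topological.copy (complexification X) (X * X)%type.

Section ComplexScaling.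
Variables (R : realType) (X : lmodType R).

Definition cscale (c : R[i]) (z : complexification X) : complexification X :=
  (complex.Re c *: z.1 - complex.Im c *: z.2,
   complex.Re c *: z.2 + complex.Im c *: z.1).

Lemma cscaleA a b z : cscale a (cscale b z) = cscale (a * b) z.
Proof.
case: a b z => [a a'] [b b'] [x y]; rewrite /cscale /=.
by congr pair; rewrite !(scalerBr, scalerDr, scalerBl, scalerDl, scalerA) ?opprD;
   rewrite [RHS]addrACA [X in _ = _ + X]addrC.
Qed.

Lemma cscale1 : left_id 1 cscale.
Proof. by case=> x y; rewrite /cscale /= !scale1r !scale0r subr0 addr0. Qed.

Lemma cscaleDr : right_distributive cscale +%R.
Proof.
move=> [a b] [x y] [x' y']; rewrite /cscale /=.
by congr pair; rewrite !scalerDr ?opprD addrACA.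
Qed.

Lemma cscaleDl z : {morph cscale^~ z : a b / a + b}.
Proof.
case: z => x y [a a'] [b b']; rewrite /cscale /=.
by congr pair; rewrite !scalerDl ?opprD addrACA.
Qed.

HB.instance Definition _ := GRing.Zmodule_isLmodule.Build R[i]
  (complexification X) cscaleA cscale1 cscaleDr cscaleDl.

End ComplexScaling.

Definition embC (X : zmodType) (x : X) : complexification X := (x, 0).

Definition complexify (X Y : Type) (f : X -> Y) (z : complexification X) :
  complexification Y := (f z.1, f z.2).

Section OrderedBanach.
Variables (R : realType) (X : normedModType R).
Implicit Type K : set X.

Record ordering_cone K : Prop := OrderingCone {
  cone_closed : closed K;
  cone_add : forall x y, K x -> K y -> K (x + y);
  cone_scale : forall (a : R) x, 0 <= a -> K x -> K (a *: x);
  cone_pointed : K `&` [set - x | x in K] = [set 0] }.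

Definition cone_le K (x y : X) : Prop := K (y - x).

Definition generating K : Prop := [set x - y | x in K & y in K] = setT.

Definition normal_cone K : Prop := exists2 C : R, 0 < C &
  forall x y, cone_le K 0 x -> cone_le K x y -> `|x| <= C * `|y|.

Definition positive_map K (T : X -> X) : Prop :=
  forall x, cone_le K 0 x -> cone_le K 0 (T x).

(* Positivity of an operator on the complexification: it maps the copy of the
   cone into the copy of the cone. *)
Definition positive_mapC K (T : complexification X -> complexification X) :=
  forall x, cone_le K 0 x ->
    exists2 u, cone_le K 0 u & T (embC x) = embC u.

Definition dist_set (x : X) (S : set X) : R := inf [set `|x - y| | y in S].

Definition op_norm (T : X -> X) : \bar R :=
  ereal_sup [set `|T x|%:E | x in [set x | `|x| <= 1]].

Definition rank1 (T : X -> X) : Prop :=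
  exists2 u : X, u != 0 & range T = [set a *: u | a in [set: R]].

End OrderedBanach.

(* An unbounded operator is a linear map A : D -> X, where the vector subspace D
   of X is given as a subtype with inclusion val. *)
Section Spectrum.
Variables (R : realType) (X : normedModType R) (S : pred X).
Variables (D : subLmodType S) (A : {linear D -> X}).

(* A^{-1} as a map of X into itself; meaningful when A is bijective. *)
Definition op_inv (y : X) : X := xget 0 [set val x | x in [set x : D | A x = y]].

(* l - A, for the canonical extension of A to the complexification. *)
Definition resolvent_shift (l : R[i]) (z : complexification D) :
  complexification X := l *: complexify val z - complexify A z.

(* (l - A)^{-1}, meaningful when l - A is bijective. *)
Definition resolvent (l : R[i]) (w : complexification X) : complexification X :=
  xget 0 [set complexify val z | z in [set z | resolvent_shift l z = w]].

Definition resolvent_set : set R[i] :=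
  [set l | bijective (resolvent_shift l) /\ continuous (resolvent l)].

Definition spectrum : set R[i] := ~` resolvent_set.

Definition spectral_bound : \bar R :=
  ereal_sup [set (complex.Re l)%:E | l in spectrum].

Definition real_spectral_bound : \bar R :=
  ereal_sup [set r%:E | r in [set r : R | spectrum r%:C]].

Definition resolvent_positive (K : set X) : Prop :=
  exists w : R, forall l : R, w < l ->
    resolvent_set l%:C /\ positive_mapC K (resolvent l%:C).

End Spectrum.

(* Main.v *)
Require Import Defs.
From HB Require Import structures.
From mathcomp Require Import all_boot all_order all_algebra.
From mathcomp Require Import all_classical all_reals all_analysis.
From mathcomp Require Import complex ring lra.
Import Order.TTheory GRing.Theory Num.Theory numFieldNormedType.Exports.
Local Open Scope classical_set_scope.
Local Open Scope ring_scope.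
Local Open Scope complex_scope.

(** The theorem rests on a description of the resolvent on the right of the
    spectrum. A positive resolvent at a real point [l] controls every positive
    resolvent at a point [m > l]: iterating the resolvent identity gives
    [0 <= (m - l)^n R(m)^(n+1) <= R(l)] on the cone, so normality and the
    generating property bound [(m - l)^n R(m)^(n+1)] in norm, and the Neumann
    series of the resolvent at [m] converges on the complex disc of center [m]
    and radius [m - l] ([complex_resolvent_disc]). As [m] may be arbitrarily
    large, the discs fill the half plane [Re z > l]
    ([complex_resolvent_half_plane]). On the other hand positivity propagates
    downwards along any half line of the real resolvent set
    ([positive_resolvent_of_ray]): Neumann series with positive terms have
    positive sums, and near a point of the resolvent set the length of the step
    they allow is bounded from below. Together these give [s(A) = s_R(A)]
    ([spectral_bounds_eq]) and the implication from (i) to (ii).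

    The implications (ii) to (iii) to (iv) to (v) are short once two facts on
    generating cones in Banach spaces are known: every vector is a difference
    of positive vectors of comparable norm ([bounded_decomposition]), and every
    positive linear map is bounded ([positive_linear_bounded]).

    For (vi) to (i), suppose that a positive resolvent [R(l)], [l >= 0], is
    large at a positive [y]. Put [x = R(l) y], so that [A x = l x - y], and take
    a positive functional [f] that nearly norms [x], obtained from the
    Hahn-Banach theorem ([positive_norming_functional]). Then
    [P = (f / f x) y] is positive, of rank one and of small norm, while
    [(A + P) x = l x >= 0]. Hence (vi) bounds all positive resolvents at
    nonnegative points by one constant ([resolvent_bound_of_rank1]); downward
    steps of a fixed length are then always possible and lead to a positive
    resolvent at a negative point ([negative_positive_resolvent]), and
    both spectral bounds are at most this point. *)

Set Implicit Arguments.
Unset Strict Implicit.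
Unset Printing Implicit Defensive.

(** * Bounded maps and Neumann series *)

Definition bounded_map (R : realType) (V W : normedModType R) (T : V -> W) :=
  exists L : R, forall v, `|T v| <= L * `|v|.

Lemma bounded_mapP (R : realType) (V W : normedModType R)
    (T : {linear V -> W}) :
  bounded_map T <-> continuous T.
Proof.
rewrite -linear_bounded_continuous linear_boundedP; split=> [[L TL]|].
  exists L; split; first exact: num_real.
  by move=> r /ltW Lr v; apply: le_trans (TL v) _; exact: ler_wpM2r.
by move=> /pinfty_ex_gt0[r _ Tr]; exists r.
Qed.

Lemma iter_linear (R : pzRingType) (V : lmodType R) (T : {linear V -> V})
    (n : nat) : linear (iter n T).
Proof. by elim: n => // n IH a x y; rewrite !iterS IH linearP. Qed.

Lemma cvg_series_geometric_bound (R : realType) (V : completeNormedModType R)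
    (u : V ^nat) (B q : R) (q0 : 0 <= q) (q1 : q < 1)
    (uB : forall n, `|u n| <= B * q ^+ n) :
  exists2 s, series u @ \oo --> s & `|s| <= B / (1 - q).
Proof.
have q1n : `|q| < 1 by rewrite ger0_norm.
have ncu : cvgn [normed series u].
  apply: (@series_le_cvg _ _ (geometric B q)) => [n|n|n|] /=.
  - exact: normr_ge0.
  - exact: le_trans (normr_ge0 _) (uB n).
  - exact: uB.
  - exact: is_cvg_geometric_series.
exists (limn (series u)); first exact: normed_cvg.
apply: le_trans (lim_series_norm ncu) _.
have gB := cvg_geometric_series q1n (a := B).
rewrite -(cvg_lim _ gB)//.
by apply: lim_series_le => //; exact: cvgP gB.
Qed.

(** The bound is on the iterates of [W] rather than on [W] itself, because for
    the resolvent only the powers are controlled, up to a constant [B]. The sum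
    of the series is part of the conclusion, so that positivity passes from the
    terms to the inverse. *)
Lemma neumann_inverse (R : realType) (V : completeNormedModType R)
    (W : {linear V -> V}) (B q : R) (q0 : 0 <= q) (q1 : q < 1)
    (WB : forall n v, `|iter n W v| <= B * q ^+ n * `|v|) :
  exists N : {linear V -> V},
    [/\ cancel (fun v => v - W v) N, cancel N (fun v => v - W v),
        bounded_map N &
        forall v, series (fun n => iter n W v) @ \oo --> N v].
Proof.
have sN v : exists2 s, series (fun n => iter n W v) @ \oo --> s &
    `|s| <= B * `|v| / (1 - q).
  by apply: cvg_series_geometric_bound => // n; rewrite mulrAC.
pose N v := xget 0 [set s | series (fun n => iter n W v) @ \oo --> s /\
    `|s| <= B * `|v| / (1 - q)].
have NP v : series (fun n => iter n W v) @ \oo --> N v /\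
    `|N v| <= B * `|v| / (1 - q).
  by rewrite /N; case: xgetP => // /(_ _)/= nN; have [s s1 s2] := sN v; case: (nN s).
have Wcont : continuous W.
  by apply/bounded_mapP; exists (B * q ^+ 1) => v; exact: WB 1 v.
have W0 v : (fun n => iter n W v) @ \oo --> (0 : V).
  by apply: cvg_series_cvg_0; apply: cvgP (NP v).1.
(* The partial sums telescope: applied to [v] or to [v - W v], they show that
   the sum is a right and a left inverse of [id - W]. *)
have telescope v n :
    series (fun n => iter n W v) n - W (series (fun n => iter n W v) n) =
    v - iter n W v.
  rewrite /series /=; elim: n => [|n IH];
    first by rewrite big_geq// linear0 !subr0 subrr.
  by rewrite big_nat_recr//= linearD opprD addrACA IH addrA subrK.
have cN : cancel N (fun v => v - W v).
  move=> v; have c1 : v - iter n W v @[n --> \oo] --> v - 0.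
    by apply: cvgB; [exact: cvg_cst|exact: W0].
  have c2 : v - iter n W v @[n --> \oo] --> N v - W (N v).
    under eq_fun do rewrite -telescope.
    apply: cvgB; first exact: (NP v).1.
    by apply: continuous_cvg; [exact: Wcont|exact: (NP v).1].
  by rewrite -[RHS]subr0; exact: cvg_unique c2 c1.
have cI : cancel (fun v => v - W v) N.
  move=> v; have c1 : v - iter n W v @[n --> \oo] --> v - 0.
    by apply: cvgB; [exact: cvg_cst|exact: W0].
  rewrite -[RHS]subr0; apply: cvg_unique c1 => //.
  rewrite (_ : (fun n => v - iter n W v) = series (fun n => iter n W (v - W v))).
    exact: (NP _).1.
  apply/funext=> n; rewrite /series /=; elim: n => [|n IH].
    by rewrite big_geq// subrr.
  rewrite big_nat_recr//= -IH.
  have -> : iter n W (v - W v) = iter n W v - iter n W (W v).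
    by elim: n {IH} => //= n ->; rewrite linearB.
  by rewrite -iterSr iterS addrA subrK.
have W'lin : linear (fun v => v - W v).
  by move=> a x y; rewrite linearP scalerBr opprD addrACA.
pose W' : {linear V -> V} :=
  HB.pack (fun v => v - W v) (GRing.isLinear.Build _ _ _ _ _ W'lin).
have Nlin : linear N by exact: (@can2_linear _ _ _ W' N cI cN).
pose N' : {linear V -> V} := HB.pack N (GRing.isLinear.Build _ _ _ _ _ Nlin).
exists N'; split => //=.
  by exists (B / (1 - q)) => v; rewrite mulrAC; exact: (NP v).2.
by move=> v; exact: (NP v).1.
Qed.

(** The Neumann series of a complexified operator lives on a product of two
    Banach spaces, with the maximum norm. *)
HB.saturate prod.

Lemma prod_cauchy_cvg (U V : completeType) (F : set_system (U * V)) :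
  ProperFilter F -> cauchy F -> cvg F.
Proof.
move=> FF cF.
have c1 : cvg (fst @ F).
  apply: cauchy_cvg => A entA.
  have [[B C] /= [FB FC] BCA] := cF _ (prod_entP entA (@entourageT V)).
  exists (fst @` B, fst @` C) => /=.
    by split; [apply: filterS FB|apply: filterS FC] => x; exists x.
  by case=> a b [/= [x Bx <-] [y Cy <-]]; have [] := BCA (x, y) (conj Bx Cy).
have c2 : cvg (snd @ F).
  apply: cauchy_cvg => A entA.
  have [[B C] /= [FB FC] BCA] := cF _ (prod_entP (@entourageT U) entA).
  exists (snd @` B, snd @` C) => /=.
    by split; [apply: filterS FB|apply: filterS FC] => x; exists x.
  by case=> a b [/= [x Bx <-] [y Cy <-]]; have [] := BCA (x, y) (conj Bx Cy).
apply/cvg_ex; exists (lim (fst @ F), lim (snd @ F)).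
rewrite -[X in X --> _](_ : (fun x : U * V => (x.1, x.2)) @ F = F).
  exact: cvg_pair c1 c2.
by rewrite (_ : (fun x => _) = id) //; apply/funext => -[].
Qed.

HB.instance Definition _ (R : numFieldType) (U V : completeNormedModType R) :=
  Uniform_isComplete.Build (U * V)%type (@prod_cauchy_cvg U V).

(** * Generating and normal cones *)

Section Cone.
Variables (R : realType) (X : completeNormedModType R) (K : set X).
Hypothesis HK : ordering_cone K.

Lemma cone_0 : K 0.
Proof. by have : [set (0 : X)] 0 by []; rewrite -(cone_pointed HK) => -[]. Qed.

Lemma cone_sum n (u : X ^nat) : (forall k, K (u k)) -> K (series u n).
Proof.
move=> Ku; rewrite /series /=; elim: n => [|n IH].
  by rewrite big_geq//; exact: cone_0.
by rewrite big_nat_recr//=; exact: (cone_add HK).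
Qed.

Lemma cone_series (u : X ^nat) (s : X) :
  (forall n, K (u n)) -> series u @ \oo --> s ->
  K s /\ forall n, K (s - u n).
Proof.
move=> Ku us; split.
  apply: (closed_cvg K (cone_closed HK) _ _ us).
  by apply: nearW => n; exact: cone_sum.
move=> n; have usn : series u m - u n @[m --> \oo] --> s - u n.
  by apply: cvgB us _; exact: cvg_cst.
apply: (closed_cvg K (cone_closed HK) _ _ usn).
exists n.+1 => // m /=; elim: m => // m IH; rewrite ltnS leq_eqVlt.
rewrite /series /= big_nat_recr//=.
case/predU1P => [->|/IH]; first by rewrite addrK; exact: cone_sum.
by rewrite addrAC => Km; exact: (cone_add HK).
Qed.

Hypothesis Kgen : generating K.

(** The differences of positive vectors of norm at most [n] fill the space as
    [n] grows, so by Baire the closure of one of these sets contains a ball.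
    Subtracting the center of the ball gives approximate decompositions of all
    vectors near 0, and scaling those of all vectors. *)
Lemma approximate_decomposition : exists2 C : R, 0 < C & forall x, exists y z,
  [/\ K y, K z, `|y| <= C * `|x|, `|z| <= C * `|x| &
      `|x - (y - z)| <= `|x| / 2].
Proof.
pose B (r : R) := [set y | K y /\ `|y| <= r].
pose A r := [set y - z | y in B r & z in B r].
have AB r x y : A r x -> A r y -> A (r + r) (x - y).
  move=> [a [Ka ra] [b [Kb rb] <-]] [c [Kc rc] [d [Kd rd] <-]].
  exists (a + d).
    by split; [exact: (cone_add HK)|apply: le_trans (ler_normD _ _) (lerD _ _)].
  exists (b + c).
    by split; [exact: (cone_add HK)|apply: le_trans (ler_normD _ _) (lerD _ _)].
  by rewrite !opprD opprK addrACA [d - c]addrC.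
pose O n := ~` closure (A n%:R).
have Ocap : \bigcap_n O n = set0.
  rewrite -subset0 => x Ox.
  have : setT x by []. rewrite -Kgen => -[y Ky [z Kz xyz]].
  pose n := (Num.trunc (`|y| + `|z|)).+1.
  have nyz : `|y| + `|z| <= n%:R by apply: ltW; exact: truncnS_gt.
  apply: (Ox n) => //; apply: subset_closure; exists y.
    by split=> //; apply: le_trans nyz; rewrite lerDl.
  by exists z => //; split=> //; apply: le_trans nyz; rewrite lerDr.
have [n ndO] : exists n, ~ dense (O n).
  apply/existsNP => dO.
  have : dense (\bigcap_n O n).
    apply: Baire => n; split; last exact: dO.
    by apply: closed_openC; exact: closed_closure.
  rewrite Ocap => /(_ setT) -[||x []//]; last exact: openT.
  by exists 0.
move/denseNE: ndO => [U [[x0 /open_nbhs_nbhs/nbhs_ballP[r /= r0 rU]] UO]].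
have near0 x e : `|x| < r -> 0 < e -> exists2 a, A n%:R a & `|x0 + x - a| < e.
  move=> xr e0; have : closure (A n%:R) (x0 + x).
    apply: contrapT => nA; rewrite -[False]/(set0 (x0 + x)) -UO; split=> //.
    by apply: rU; rewrite -ball_normE /= opprD addrA subrr sub0r normrN.
  move=> /(_ _ (nbhsx_ballx (x0 + x) e e0))[a [Aa]].
  by rewrite -ball_normE /= => xa; exists a.
have smalldec x e : `|x| < r -> 0 < e ->
    exists2 a, A (n%:R + n%:R) a & `|x - a| < e.
  move=> xr e0; have e20 : 0 < e / 2 by rewrite divr_gt0.
  have [a Aa xa] := near0 x _ xr e20.
  have [b Ab xb] : exists2 a, A n%:R a & `|x0 + 0 - a| < e / 2.
    by apply: near0 => //; rewrite normr0.
  exists (a - b); first exact: AB.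
  rewrite [e]splitr; apply: le_lt_trans (ltrD xa xb).
  have -> : x - (a - b) = (x0 + x - a) - (x0 + 0 - b).
    rewrite addr0 !opprB [RHS](AC (3*2) ((1*5)*(2*(4*3))))/=.
    by rewrite subrr add0r.
  exact: ler_normB.
pose N : R := n%:R + n%:R.
have N0 : 0 <= N by rewrite addr_ge0.
(* [N] may vanish; adding 1 keeps the constant positive. *)
exists (2 * (N + 1) / r); first by rewrite divr_gt0// mulr_gt0// ltr_wpDl.
move=> x; have [->|x_neq0] := eqVneq x 0.
  exists 0, 0; rewrite !subr0 normr0 mulr0 mul0r.
  by split; [exact: cone_0|exact: cone_0| | |].
have x_gt0 : 0 < `|x| by rewrite normr_gt0.
pose t := r / (2 * `|x|).
have t_gt0 : 0 < t by rewrite divr_gt0// mulr_gt0.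
have tx : `|t *: x| < r.
  rewrite normrZ gtr0_norm// /t; rewrite invfM mulrA mulfVK ?gt_eqF//.
  by rewrite ltr_pdivrMr// ltr_pMr// ltr1n.
have r40 : 0 < r / 4 by rewrite divr_gt0.
have [_ [y [Ky yN] [z [Kz zN] <-]] xyz] := smalldec _ _ tx r40.
have tN w : `|w| <= N -> `|t^-1 *: w| <= 2 * (N + 1) / r * `|x|.
  move=> wN; rewrite normrZ gtr0_norm ?invr_gt0// mulrC ler_pdivrMr//.
  apply: le_trans wN _.
  rewrite (_ : _ * t = N + 1); first by rewrite lerDl.
  by rewrite /t; field; rewrite !gt_eqF.
exists (t^-1 *: y), (t^-1 *: z); split; [| |exact: tN|exact: tN|].
- by apply: (cone_scale HK) => //; rewrite ltW// invr_gt0.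
- by apply: (cone_scale HK) => //; rewrite ltW// invr_gt0.
rewrite -scalerBr -[x in `|x - _|](scalerK (lt0r_neq0 t_gt0)) -scalerBr.
rewrite normrZ gtr0_norm ?invr_gt0// mulrC ler_pdivrMr//.
apply: le_trans (ltW xyz) _.
by rewrite /t le_eqVlt; apply/orP; left; apply/eqP; field; rewrite gt_eqF.
Qed.

(** A quantitative form of the generating property, as in the proof of the open
    mapping theorem: decompose approximately, then decompose the error, which
    is halved each time, and sum the positive and the negative parts. *)
Theorem bounded_decomposition : exists2 M : R, 0 < M & forall x, exists y z,
  [/\ K y, K z, x = y - z, `|y| <= M * `|x| & `|z| <= M * `|x| ].
Proof.
have [C C0 /choice[y /choice[z yzP]]] := approximate_decomposition.
exists (C * 2); first by rewrite mulr_gt0.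
move=> x; pose e n := iter n (fun v => v - (y v - z v)) x.
have eB n : `|e n| <= `|x| * 2^-1 ^+ n.
  elim: n => [|n IH]; first by rewrite expr0 mulr1.
  have [_ _ _ _] := yzP (e n); rewrite -/(e n.+1) => /le_trans; apply.
  by rewrite exprSr mulrA ler_wpM2r.
have sum (w : X -> X) : (forall v, K (w v) /\ `|w v| <= C * `|v|) ->
    exists2 s, series (w \o e) @ \oo --> s & K s /\ `|s| <= C * 2 * `|x|.
  move=> wP; have [] := @cvg_series_geometric_bound _ _ (w \o e) (C * `|x|) 2^-1.
  - by [].
  - by rewrite invf_lt1// ltr1n.
  - move=> n /=; apply: le_trans (wP _).2 _.
    by rewrite -mulrA ler_wpM2l// ltW.
  move=> s ws sB; exists s => //; split.
    by have [] := cone_series (fun n => (wP (e n)).1) ws.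
  apply: le_trans sB _; rewrite le_eqVlt; apply/orP; left; apply/eqP.
  by field.
have /sum[s ys [Ks sB]] v : K (y v) /\ `|y v| <= C * `|v| by have [] := yzP v.
have /sum[t zt [Kt tB]] v : K (z v) /\ `|z v| <= C * `|v| by have [] := yzP v.
exists s, t; split=> //.
have e0 : e @ \oo --> (0 : X).
  have [||s' es' _] := cvg_series_geometric_bound _ _ eB.
  - by [].
  - by rewrite invf_lt1// ltr1n.
  exact: cvg_series_cvg_0 (cvgP _ es').
have tel n : series (y \o e) n - series (z \o e) n = x - e n.
  rewrite /series /=; elim: n => [|n IH];
    first by rewrite !big_geq// subr0 /e /= subrr.
  rewrite !big_nat_recr// [x - e n.+1](_ : _ = x - (e n - (y (e n) - z (e n))))//.
  by rewrite opprD addrACA IH opprB -addrA [- e n + _]addrC.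
have c1 : x - e n @[n --> \oo] --> x - 0 by apply: cvgB => //; exact: cvg_cst.
have c2 : x - e n @[n --> \oo] --> s - t.
  by under eq_fun do rewrite -tel; exact: cvgB.
by rewrite -[LHS]subr0; exact: cvg_unique c1 c2.
Qed.

(** The constant does not depend on the operator, which makes uniform bounds on
    the cone uniform on the whole space. *)
Lemma bounded_on_cone : exists2 M : R, 0 < M &
  forall (Y : normedModType R) (T : {linear X -> Y}) (L : R), 0 <= L ->
    (forall x, K x -> `|T x| <= L * `|x|) -> forall x, `|T x| <= M * L * `|x|.
Proof.
have [M M0 dec] := bounded_decomposition; exists (M *+ 2) => [|Y T L L0 TL x].
  by rewrite pmulrn_lgt0.
have [y [z [Ky Kz -> yM zM]]] := dec x; rewrite linearB.
set n := `|y - z| in yM zM *.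
apply: le_trans (ler_normB _ _) _; rewrite mulr2n 2!mulrDl; apply: lerD.
  by apply: le_trans (TL _ Ky) _; rewrite [M * L]mulrC -mulrA ler_wpM2l.
by apply: le_trans (TL _ Kz) _; rewrite [M * L]mulrC -mulrA ler_wpM2l.
Qed.

Hypothesis Knormal : normal_cone K.

Lemma normality : exists2 C : R, 0 < C &
  forall x y, K x -> K (y - x) -> `|x| <= C * `|y|.
Proof.
have [C C0 KC] := Knormal; exists C => // x y Kx Kyx.
by apply: KC => //; rewrite /cone_le subr0.
Qed.

(** If [T] is unbounded, there are positive [u n] with summable norms and
    [`|T (u n)| > n]. Their sum [s] dominates each [u n], so [T s] dominates each
    [T (u n)], which contradicts normality. *)
Theorem positive_linear_bounded (T : {linear X -> X}) :
  (forall x, K x -> K (T x)) -> bounded_map T.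
Proof.
move=> Tpos; have [M M0 bc] := bounded_on_cone; have [C C0 KC] := normality.
apply: contrapT => unbounded.
have /choice[u uP] : forall n, exists v : X,
    [/\ K v, `|v| <= 2^-1 ^+ n & n%:R < `|T v| ].
  move=> n; apply: contrapT => nov; apply: unbounded.
  exists (M * (n%:R * 2 ^+ n)); apply: bc => [|x Kx];
    first by rewrite mulr_ge0// exprn_ge0.
  rewrite leNgt; apply/negP => Tx; apply: nov.
  have [x0|x0] := eqVneq x 0;
    first by move: Tx; rewrite x0 linear0 !normr0 mulr0 ltxx.
  have nx : 0 < `|x| by rewrite normr_gt0.
  pose a := (2 ^+ n * `|x|)^-1.
  have a0 : 0 < a by rewrite invr_gt0 mulr_gt0// exprn_gt0.
  exists (a *: x); split.
  - by apply: (cone_scale HK) => //; exact: ltW.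
  - rewrite normrZ gtr0_norm// /a invfM mulfVK ?gt_eqF//.
    by rewrite exprVn.
  - rewrite linearZ/= normrZ gtr0_norm// mulrC ltr_pdivlMr ?mulr_gt0 ?exprn_gt0//.
    by rewrite mulrA.
have [|||s us _] := @cvg_series_geometric_bound _ _ u 1 2^-1.
- by [].
- by rewrite invf_lt1// ltr1n.
- by move=> n; rewrite mul1r; have [] := uP n.
have [_ Ksu] := cone_series (fun n => let: And3 k _ _ := uP n in k) us.
pose n := (Num.trunc (C * `|T s|)).+1.
have [Kun _] := uP n; apply/negP; rewrite -leNgt.
apply: (@le_trans _ _ (C * `|T s|)); last by apply: ltW; exact: truncnS_gt.
by apply: KC; [exact: Tpos|rewrite -linearB; exact: Tpos].
Qed.
End Cone.

(** * The Hahn-Banach theorem and positive functionals *)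

Section HahnBanach.
Variables (R : realType) (V : lmodType R).
Implicit Types (p q : V -> R) (F : V -> set R).

(** Homogeneity is only asked as an inequality, which is what infima inherit
    directly; the equality follows by applying it to the inverse scalar. *)
Definition sublinear p :=
  (forall x y, p (x + y) <= p x + p y) /\
  (forall a x, 0 < a -> p (a *: x) <= a * p x).

Lemma sublinearZ p a x : sublinear p -> 0 < a -> p (a *: x) = a * p x.
Proof.
move=> [_ pZ] a0; apply/eqP; rewrite eq_le pZ//= -ler_pdivlMl//.
by rewrite -[x in p x <= _](scalerK (lt0r_neq0 a0)) pZ// invr_gt0.
Qed.

Lemma sublinear0 p : sublinear p -> p 0 = 0.
Proof.
move=> sp; have := sublinearZ 0 sp (ltr0Sn R 1); rewrite scaler0 => p0.
by lra.
Qed.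

Lemma sublinear_geN p x : sublinear p -> - p (- x) <= p x.
Proof.
move=> sp; have := sp.1 x (- x); rewrite subrr sublinear0// => ?.
by lra.
Qed.

(** Common to the three infima used below: along a chain of sublinear maps,
    along a half line, and over the cone. *)
Lemma sublinear_inf F :
  (forall x, F x !=set0) -> (forall x, has_lbound (F x)) ->
  (forall x y a b, F x a -> F y b -> exists2 c, F (x + y) c & c <= a + b) ->
  (forall r x a, 0 < r -> F x a -> exists2 c, F (r *: x) c & c <= r * a) ->
  sublinear (fun x => inf (F x)).
Proof.
move=> F0 Flb FD FZ; split=> [x y|r x r0].
- rewrite -lerBlDr; apply: lb_le_inf => // a Fa.
  rewrite lerBlDr -lerBlDl; apply: lb_le_inf => // b Fb.
  rewrite lerBlDl; have [c Fc] := FD _ _ _ _ Fa Fb.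
  by apply: le_trans; exact: ge_inf.
- rewrite -ler_pdivrMl//; apply: lb_le_inf => // a Fa.
  rewrite ler_pdivrMl//; have [c Fc] := FZ _ _ _ r0 Fa.
  by apply: le_trans; exact: ge_inf.
Qed.

Definition tilt_values p (x0 z : V) : set R :=
  [set p (z + t *: x0) - t * p x0 | t in [set t | 0 <= t]].

(** Below [p], this is the largest sublinear map whose value at [- x0] is at
    most [- p x0], so that a linear map below it is at least [p x0] at [x0]. *)
Definition tilt p (x0 z : V) : R := inf (tilt_values p x0 z).

Section Tilt.
Variables (p : V -> R) (x0 : V).
Hypothesis sp : sublinear p.

Let sublinearZ0 t x : 0 <= t -> p (t *: x) = t * p x.
Proof.
rewrite le_eqVlt => /predU1P[<-|t0]; last exact: sublinearZ.
by rewrite scale0r mul0r sublinear0.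
Qed.

Let tilt_lbound z : has_lbound (tilt_values p x0 z).
Proof.
exists (- p (- z)) => _ [t /= t0 <-].
have := sp.1 (z + t *: x0) (- z); rewrite addrAC subrr add0r sublinearZ0// => ?.
by lra.
Qed.

Lemma tilt_sublinear : sublinear (tilt p x0).
Proof.
apply: sublinear_inf => [z|//|z w _ _ [t /= t0 <-] [s /= s0 <-]
  |r z _ r0 [t /= t0 <-]].
- by exists (p (z + 0 *: x0) - 0 * p x0), 0 => /=.
- exists (p ((z + w) + (t + s) *: x0) - (t + s) * p x0).
    by exists (t + s) => //=; rewrite addr_ge0.
  have := sp.1 (z + t *: x0) (w + s *: x0).
  by rewrite addrACA -scalerDl => ?; lra.
- exists (p (r *: z + (r * t) *: x0) - (r * t) * p x0).
    by exists (r * t) => //=; rewrite mulr_ge0// ltW.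
  by rewrite -scalerA -scalerDr sublinearZ// mulrBr mulrA.
Qed.

Lemma tilt_le z t : 0 <= t -> tilt p x0 z <= p (z + t *: x0) - t * p x0.
Proof. by move=> t0; apply: ge_inf => //; exists t. Qed.

Lemma tilt_le_self z : tilt p x0 z <= p z.
Proof. by have := tilt_le z (lexx 0); rewrite scale0r addr0 mul0r subr0. Qed.

Lemma tiltN : tilt p x0 (- x0) <= - p x0.
Proof.
have := tilt_le (- x0) ler01.
by rewrite scale1r addNr sublinear0// mul1r sub0r.
Qed.

End Tilt.

(** Zorn's lemma: the pointwise infimum of a chain is finite because every
    member [a] of the chain satisfies [a x >= - a (- x) >= - p (- x)]. *)
Lemma minimal_sublinear p : sublinear p ->
  exists q, [/\ sublinear q, forall x, q x <= p x &
    forall s, sublinear s -> (forall x, s x <= q x) -> forall x, q x <= s x].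
Proof.
move=> sp; pose T := {q : V -> R | sublinear q /\ forall x, q x <= p x}.
pose t0 : T := exist _ p (conj sp (fun x => lexx _)).
pose le (s t : T) := `[< forall x, sval t x <= sval s x >].
have [q qmin] : exists q : T, premaximal le q.
  apply: (ZL_preorder t0).
  - by move=> t; apply/asboolP.
  - move=> r s t /asboolP rs /asboolP st; apply/asboolP => x.
    exact: le_trans (st x) (rs x).
  move=> A Atot; have [[a0 Aa0]|A0] := pselect (A !=set0); last first.
    by exists t0 => s As; exfalso; apply: A0; exists s.
  pose F x : set R := [set sval a x | a in A].
  have Flb x : has_lbound (F x).
    exists (- p (- x)) => _ [a _ <-].
    apply: le_trans (sublinear_geN x (svalP a).1).
    by rewrite lerN2; exact: (svalP a).2.
  have infle a x : A a -> inf (F x) <= sval a x.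
    by move=> Aa; apply: ge_inf => //; exists a.
  have sinf : sublinear (fun x => inf (F x)).
    apply: sublinear_inf => // [x|x y _ _ [a Aa <-] [b Ab <-]|r x _ r0 [a Aa <-]].
    - by exists (sval a0 x), a0.
    - have [/asboolP ab|/asboolP ba] := Atot a b Aa Ab.
        exists (sval b (x + y)); first by exists b.
        by apply: le_trans ((svalP b).1.1 x y) _; exact: lerD.
      exists (sval a (x + y)); first by exists a.
      by apply: le_trans ((svalP a).1.1 x y) _; exact: lerD.
    - by exists (sval a (r *: x)); [exists a|exact: (svalP a).1.2].
  have infp x : inf (F x) <= p x by apply: le_trans (infle _ _ Aa0) ((svalP a0).2 x).
  exists (exist _ _ (conj sinf infp) : T) => s As; apply/asboolP => x /=.
  exact: infle.
exists (sval q); split; [exact: (svalP q).1|exact: (svalP q).2|].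
move=> s ss sq; have sp' x : s x <= p x by apply: le_trans (sq x) ((svalP q).2 x).
have /asboolP := qmin (exist _ s (conj ss sp') : T) (asboolT sq).
by [].
Qed.

(** Tilting a minimal sublinear map in any direction does not change it, hence
    it is odd, and an odd sublinear map is linear. *)
Lemma minimal_sublinear_linear q : sublinear q ->
  (forall s, sublinear s -> (forall x, s x <= q x) -> forall x, q x <= s x) ->
  linear (q : V -> R^o).
Proof.
move=> sq qmin.
have qN x : q (- x) = - q x.
  apply/eqP; rewrite eq_le; apply/andP; split.
    apply: le_trans (tiltN x sq); apply: qmin; first exact: tilt_sublinear.
    by move=> z; exact: tilt_le_self.
  by have := sublinear_geN (- x) sq; rewrite opprK.
have qZ a x : q (a *: x) = a * q x.
  have [a0|a0|<-] := ltrgtP 0 a; first exact: sublinearZ.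
    by rewrite -[a in LHS]opprK scaleNr qN sublinearZ ?oppr_gt0// mulNr opprK.
  by rewrite scale0r mul0r sublinear0.
move=> a x y; apply/eqP; rewrite eq_le; apply/andP; split.
  by apply: le_trans (sq.1 _ _) _; rewrite qZ.
have := sq.1 (a *: x + y) (- y); rewrite addrK qN qZ => ?.
by rewrite -[a *: q x]/(a * q x); lra.
Qed.

(** A minimal sublinear map below the tilt of [p] in the direction [x0] is
    linear, lies below [p], and is at least [p x0] at [x0]. *)
Theorem hahn_banach p x0 : sublinear p ->
  exists f : {linear V -> R^o}, (forall x, f x <= p x) /\ p x0 <= f x0.
Proof.
move=> sp; have [q [sq qp qmin]] := minimal_sublinear (tilt_sublinear x0 sp).
pose f : {linear V -> R^o} := HB.pack (q : V -> R^o)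
  (GRing.isLinear.Build _ _ _ _ _ (minimal_sublinear_linear sq qmin)).
have fp x : f x <= p x := le_trans (qp x) (tilt_le_self x0 sp x).
exists f; split => //.
have := le_trans (qp (- x0)) (tiltN x0 sp).
by rewrite -[q _]/(f (- x0)) linearN lerN2.
Qed.

End HahnBanach.

Section PositiveFunctional.
Variables (R : realType) (X : completeNormedModType R) (K : set X).
Hypotheses (HK : ordering_cone K) (Knormal : normal_cone K).

(** The sublinear map to extend from is the distance to the opposite cone,
    [p z = inf (`|z + k|)] over [k] in [K]: a functional below [p] is nonpositive on
    [- K] and has norm at most 1, and normality says precisely that [p] is
    comparable with the norm on [K]. *)
Theorem positive_norming_functional : exists2 C : R, 0 < C &
  forall x, K x -> exists f : {linear X -> R^o},
    [/\ forall z, K z -> 0 <= f z, forall z, `|f z| <= `|z| & `|x| <= C * f x].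
Proof.
have [C C0 KC] := normality Knormal; exists C => // x Kx.
pose F z : set R := [set `|z + k| | k in K].
have Flb z : has_lbound (F z) by exists 0 => _ [k _ <-].
pose p z := inf (F z).
have sp : sublinear p.
  apply: sublinear_inf => // [z|z w _ _ [k Kk <-] [l Kl <-]|r z _ r0 [k Kk <-]].
  - by exists `|z + 0|, 0 => //; exact: cone_0.
  - exists `|z + w + (k + l)|; first by exists (k + l) => //; exact: (cone_add HK).
    by rewrite addrACA ler_normD.
  - exists `|r *: z + r *: k|.
      by exists (r *: k) => //; apply: (cone_scale HK) => //; exact: ltW.
    by rewrite -scalerDr normrZ gtr0_norm.
have [f [fp fx]] := hahn_banach x sp.
have pn z : p z <= `|z|.
  by apply: ge_inf => //; exists 0; [exact: cone_0|rewrite addr0].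
exists f; split.
- move=> z Kz; rewrite -oppr_le0 -linearN; apply: le_trans (fp _) _.
  by apply: ge_inf => //; exists z => //; rewrite addNr normr0.
- move=> z; rewrite ler_norml; apply/andP; split.
    by rewrite lerNl -linearN -[`|z|]normrN; exact: le_trans (fp _) (pn _).
  exact: le_trans (fp _) (pn _).
- apply: (@le_trans _ _ (C * p x)); last by rewrite ler_wpM2l// ltW.
  rewrite -ler_pdivrMl//; apply: lb_le_inf.
    by exists `|x + 0|, 0 => //; exact: cone_0.
  move=> _ [k Kk <-]; rewrite ler_pdivrMl//; apply: KC => //.
  by rewrite addrAC subrr add0r.
Qed.

End PositiveFunctional.

(** * Real and complex resolvents *)

Section RealResolvent.
Variables (R : realType) (X : completeNormedModType R).
Variables (S : pred X) (D : subLmodType S) (A : {linear D -> X}).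

(** [T] takes its values in [X] and not in [D], so that powers of a resolvent
    make sense. *)
Definition is_resolvent (l : R) (T : X -> X) :=
  (forall x : D, T (l *: val x - A x) = val x) /\
  (forall y, exists2 x : D, val x = T y & l *: val x - A x = y).

Lemma is_resolvent_linear l T : is_resolvent l T -> linear T.
Proof.
move=> [TA AT] a y z; have [x xT xy] := AT y; have [x' xT' xz] := AT z.
have -> : a *: y + z = l *: val (a *: x + x') - A (a *: x + x').
  rewrite -xy -xz [val (_ + _)]linearP [A (_ + _)]linearP /=.
  rewrite scalerBr scalerDr !scalerA.
  by rewrite mulrC opprD addrACA.
by rewrite TA linearP /= xT xT'.
Qed.

Lemma resolvent_identity l m T U : is_resolvent l T -> is_resolvent m U ->
  forall y, U y = T y + (l - m) *: T (U y).
Proof.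
move=> rT rU y; have [x <- xy] := rU.2 y.
rewrite addrC -[RHS](is_resolvent_linear rT) -[LHS]rT.1 -xy.
by congr T; rewrite scalerBl addrA subrK.
Qed.

(** The complex analogue of [is_resolvent] identifies the inverse that the
    resolvent picks out by choice. *)
Lemma complex_resolventP (l : R[i])
    (f : complexification X -> complexification X) :
  (forall z, f (resolvent_shift A l z) = complexify val z) ->
  (forall w, exists2 z, complexify val z = f w & resolvent_shift A l z = w) ->
  bijective (resolvent_shift A l) /\ resolvent A l = f.
Proof.
move=> fA Af; split.
  rewrite -setTT_bijective; split=> [//|z z' _ _ zz'|w _].
    have := fA z; rewrite zz' fA.
    by case: z z' {zz'} => [a b] [c d] [/val_inj-> /val_inj->].
  by have [z _ <-] := Af w; exists z.
apply/funext => w; rewrite /resolvent; case: xgetP => [u _ /= [z zw <-]|nz].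
  by rewrite -fA zw.
by exfalso; have [z _ zw] := Af w; apply: (nz (complexify val z)); exists z.
Qed.

Lemma resolvent_shift_real (l : R) (z : complexification D) :
  resolvent_shift A l%:C z =
  (l *: val z.1 - A z.1, l *: val z.2 - A z.2).
Proof.
rewrite /resolvent_shift; congr pair => /=.
  by rewrite scale0r subr0.
by rewrite scale0r addr0.
Qed.

Lemma continuous_complexify (T : X -> X) : continuous T ->
  continuous (complexify T : X * X -> X * X).
Proof.
move=> Tcont z;
apply: (@cvg_pair _ _ _ (nbhs z) (nbhs (T z.1)) (nbhs (T z.2)) _ _ _
  (T \o fst) (T \o snd)).
  by apply: continuous_comp; [exact: cvg_fst|exact: Tcont].
by apply: continuous_comp; [exact: cvg_snd|exact: Tcont].
Qed.

Lemma real_complex_resolvent (l : R) (T : {linear X -> X}) :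
  is_resolvent l T -> bounded_map T ->
  resolvent_set A l%:C /\ resolvent A l%:C = complexify T.
Proof.
move=> [TA AT] /bounded_mapP Tcont.
have [|w|bij resE] := @complex_resolventP l%:C (complexify T).
- by move=> z; rewrite resolvent_shift_real /complexify /= !TA.
- have [x xT xy] := AT w.1; have [x' xT' xy'] := AT w.2.
  exists (x, x'); first by rewrite /complexify /= xT xT'.
  by rewrite resolvent_shift_real /= xy xy' -surjective_pairing.
split=> //; split=> //; rewrite resE; exact: continuous_complexify.
Qed.

(** At a real point the complexified operator acts separately on real and
    imaginary parts, so the real part of the resolvent restricted to [X] is a
    real resolvent. *)
Lemma complex_real_resolvent (l : R) : resolvent_set A l%:C ->
  exists T : {linear X -> X}, [/\ is_resolvent l T, bounded_map T &
    forall x, T x = (resolvent A l%:C (embC x)).1].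
Proof.
move=> [bij cont].
pose T (y : X) : X := (resolvent A l%:C (embC y)).1.
have inj := bij_inj bij.
have resP (w : complexification X) : exists2 z,
    resolvent_shift A l%:C z = w & resolvent A l%:C w = complexify val z.
  rewrite /resolvent; case: xgetP => [u _ [z zw <-]|nz]; first by exists z.
  exfalso; case: bij => g _ gK.
  by apply: (nz (complexify val (g w))); exists (g w) => //=.
have rT : is_resolvent l T.
  split=> [x|y].
    rewrite /T; have [z + ->] := resP (embC (l *: val x - A x)).
    rewrite (_ : embC _ = resolvent_shift A l%:C (x, 0)).
      by move=> /inj->.
    by rewrite resolvent_shift_real /= !linear0 addr0.
  rewrite /T; have [z + ->] := resP (embC y).
  by rewrite resolvent_shift_real => -[zy _]; exists z.1.
pose T' : {linear X -> X} :=
  HB.pack T (GRing.isLinear.Build _ _ _ _ _ (is_resolvent_linear rT)).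
exists T'; split=> //; apply/bounded_mapP => y.
apply: (@continuous_comp _ _ _ (resolvent A l%:C \o @embC X) fst);
  last exact: cvg_fst.
apply: (@continuous_comp _ _ _ (@embC X) (resolvent A l%:C)); last exact: cont.
by apply: (@cvg_pair _ _ _ _ (nbhs y)); [exact: cvg_id|exact: cvg_cst].
Qed.

End RealResolvent.

(** * Positive resolvents and the spectrum *)

Section PositiveResolvent.
Variables (R : realType) (X : completeNormedModType R) (K : set X).
Hypotheses (HK : ordering_cone K) (Kgen : generating K).
Hypothesis Knormal : normal_cone K.
Variables (S : pred X) (D : subLmodType S) (A : {linear D -> X}).

Definition positive_resolvent_at (l : R) (T : {linear X -> X}) :=
  is_resolvent A l T /\ forall x, K x -> K (T x).

(** [l - d - A = (id - d T) (l - A)], and the Neumann series of [d T] has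
    positive terms. *)
Lemma resolvent_step l T L d : positive_resolvent_at l T ->
  (forall x, `|T x| <= L * `|x|) -> 0 <= L -> 0 <= d -> d * L < 1 ->
  exists U, positive_resolvent_at (l - d) U.
Proof.
move=> [[TA AT] TK] TL L0 d0 dL.
pose W : {linear X -> X} := d \*: T.
have WB n v : `|iter n W v| <= 1 * (d * L) ^+ n * `|v|.
  rewrite mul1r; elim: n => [|n IH]; first by rewrite expr0 mul1r.
  rewrite iterS exprS -!mulrA /= normrZ ger0_norm// ler_wpM2l//.
  by apply: le_trans (TL _) _; rewrite ler_wpM2l// mulrA.
have [N [WN NW _ Nser]] := neumann_inverse (mulr_ge0 d0 L0) dL WB.
exists (T \o N); split; first split.
- move=> x /=; rewrite -[X in N X](_ : l *: val x - A x -
      W (l *: val x - A x) = (l - d) *: val x - A x); first by rewrite WN TA.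
  by rewrite /= TA scalerBl addrAC.
- move=> y; have [x xT xN] := AT (N y); exists x => //.
  by rewrite -[RHS]NW -[in RHS]xN /= TA scalerBl addrAC.
- move=> x Kx /=; apply: (TK); apply: (cone_series HK _ (Nser x)).1.
  elim=> //= n IH.
  by apply: (cone_scale HK) => //; exact: TK.
Qed.

(** The heart of the matter: by induction from the resolvent identity
    [T = U + (m - l) U T], the positive operators [(m - l)^n U^(n+1)] are all
    dominated by [T]. Their norms are therefore bounded, although nothing is
    known on the norm of [(m - l) U]. *)
Lemma resolvent_power_bound l m T U : positive_resolvent_at l T ->
  positive_resolvent_at m U -> l < m ->
  exists2 B, 0 <= B & forall n x, `|iter n U x| <= B * (m - l)^-1 ^+ n * `|x|.
Proof.
move=> [rT TK] [rU UK] lm; set r := m - l.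
have r0 : 0 < r by rewrite subr_gt0.
have TU y : T y = U y + r *: U (T y) by exact: (resolvent_identity rU rT).
have dom n x : K x -> K (T x - r ^+ n *: iter n.+1 U x).
  move=> Kx; elim: n => [|n IH].
    rewrite expr0 scale1r /= TU addrAC subrr add0r.
    by apply: (cone_scale HK); [exact: ltW|exact/UK/TK].
  rewrite [T x]TU exprS -scalerA -addrA -scalerBr /=.
  rewrite -[_ *: U (U _)]linearZ -linearB /=.
  apply: (cone_add HK); first exact: UK.
  by apply: (cone_scale HK); [exact: ltW|exact: UK].
have UnK n x : K x -> K (iter n U x) by move=> Kx; elim: n => //= n; exact: UK.
have [C C0 KC] := normality Knormal.
have [M M0 bc] := bounded_on_cone HK Kgen.
have [L TL] := positive_linear_bounded HK Kgen Knormal TK.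
pose B := M * (C * `|L|).
have B0 : 0 <= B by rewrite !mulr_ge0// ltW.
have UB n x : `|iter n.+1 U x| <= B * r * r^-1 ^+ n.+1 * `|x|.
  pose V : {linear X -> X} :=
    HB.pack (iter n.+1 U) (GRing.isLinear.Build _ _ _ _ _ (iter_linear U n.+1)).
  have -> : B * r * r^-1 ^+ n.+1 = M * (C * `|L| * r^-1 ^+ n).
    by rewrite exprS [RHS]mulrA -/B [LHS]mulrA mulfK ?gt_eqF.
  apply: (bc _ V) => [|{}x Kx];
    first by rewrite mulr_ge0 ?mulr_ge0 ?exprn_ge0 ?invr_ge0 //; exact: ltW.
  rewrite mulrAC exprVn ler_pdivlMr ?exprn_gt0//.
  have <- : `|r ^+ n *: V x| = `|V x| * r ^+ n.
    by rewrite normrZ gtr0_norm ?exprn_gt0// mulrC.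
  apply: le_trans (KC _ _ _ (dom n x Kx)) _.
    by apply: (cone_scale HK); [rewrite exprn_ge0// ltW|exact: UnK].
  rewrite -mulrA ler_wpM2l ?(ltW C0)//; apply: le_trans (TL x) _.
  by rewrite ler_wpM2r// ler_norm.
(* The summand 1 takes care of the exponent 0, the rest of the others. *)
exists (1 + B * r) => [|[|n] x]; first by rewrite addr_ge0// mulr_ge0// ltW.
  by rewrite expr0 mulr1 /= ler_peMl// lerDl mulr_ge0// ltW.
apply: le_trans (UB n x) _; rewrite !ler_wpM2r//.
  by rewrite exprn_ge0// invr_ge0 ltW.
by rewrite lerDr.
Qed.

(** [z - A = (id - w U) (m - A)] with [w = m - z]. The bound on the powers of
    [U] makes the Neumann series of [w U] converge as soon as [|w| < m - l]. *)
Lemma complex_resolvent_disc (l m : R) (T U : {linear X -> X}) (z : R[i]) :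
  positive_resolvent_at l T -> positive_resolvent_at m U -> l < m ->
  `|m%:C - z| < (m - l)%:C -> resolvent_set A z.
Proof.
move=> pT pU lm zm; pose w : R[i] := m%:C - z; rewrite -[_ - _]/w in zm.
have [[UA AU] UK] := pU.
pose r := m - l; have r0 : 0 < r by rewrite subr_gt0.
pose c := complex.Re `|w|.
have wc : `|w| = c%:C by rewrite /c normc_def.
have c0 : 0 <= c by rewrite -lecR -wc; exact: normr_ge0.
have cr : c < r by rewrite -ltcR -wc.
have cn n : (c ^+ n)%:C = `|w| ^+ n by rewrite wc rmorphXn.
have Re_w n : `|complex.Re (w ^+ n)| <= c ^+ n.
  by rewrite -lecR cn -normrX; exact: normc_ge_Re.
have Im_w n : `|complex.Im (w ^+ n)| <= c ^+ n.
  rewrite -lecR cn -normrX normc_def lecR -sqrtr_sqr.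
  by rewrite ler_wsqrtr// lerDr sqr_ge0.
pose W0 (v : X * X) : X * X := Defs.cscale w (U v.1, U v.2).
have W0lin : linear W0.
  by move=> a u v; rewrite /W0 /Defs.cscale; congr pair => /=;
     rewrite !linearP /= addrACA !scalerA (mulrC a).
pose W : {linear (X * X)%type -> (X * X)%type} :=
  HB.pack W0 (GRing.isLinear.Build _ _ _ _ _ W0lin).
have [B B0 UB] := resolvent_power_bound pT pU lm.
have WE n v : iter n W v = Defs.cscale (w ^+ n) (iter n U v.1, iter n U v.2).
  elim: n v => [|n IH] v; first by rewrite expr0 cscale1; case: v.
  rewrite iterS IH exprS -cscaleA; congr (Defs.cscale w _).
  by rewrite /Defs.cscale /= linearB linearD !linearZ.
have WB n v : `|iter n W v| <= 2 * B * (c / r) ^+ n * `|v|.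
  rewrite WE prod_normE /=.
  have side (s t : R) (x y : X) : `|s| <= c ^+ n -> `|t| <= c ^+ n ->
      `|x| <= B * r^-1 ^+ n * `|v| -> `|y| <= B * r^-1 ^+ n * `|v| ->
      `|s *: x + t *: y| <= 2 * B * (c / r) ^+ n * `|v|.
    move=> sc tc xv yv; apply: le_trans (ler_normD _ _) _; rewrite !normrZ.
    have -> : 2 * B * (c / r) ^+ n * `|v| =
      c ^+ n * (B * r^-1 ^+ n * `|v|) + c ^+ n * (B * r^-1 ^+ n * `|v|).
      by rewrite expr_div_n exprVn; ring.
    by apply: lerD; apply: ler_pM.
  have Bn : 0 <= B * r^-1 ^+ n by rewrite mulr_ge0// exprn_ge0// invr_ge0 ltW.
  have v1 : `|iter n U v.1| <= B * r^-1 ^+ n * `|v|.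
    by apply: le_trans (UB n v.1) _; rewrite ler_wpM2l// prod_normE le_max lexx.
  have v2 : `|iter n U v.2| <= B * r^-1 ^+ n * `|v|.
    by apply: le_trans (UB n v.2) _; rewrite ler_wpM2l// prod_normE le_max lexx orbT.
  rewrite ge_max; apply/andP; split.
    by rewrite -scaleNr; apply: side; rewrite ?normrN.
  exact: side.
have [||N [WN NW /bounded_mapP Ncont _]] :=
  @neumann_inverse R (X * X)%type W (2 * B) (c / r) _ _ WB.
- by rewrite divr_ge0// ltW.
- by rewrite ltr_pdivrMr// mul1r.
(* The same factorization in additive form: [z - A = (m - A) - w]. *)
have shiftE d : resolvent_shift A z d =
    resolvent_shift A m%:C d - Defs.cscale w (complexify val d).
  have {1}-> : z = m%:C - w by rewrite /w opprB addrC subrK.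
  by rewrite /resolvent_shift scalerBl addrAC.
have [|v|bij resE] := @complex_resolventP _ _ _ _ A z (complexify U \o N).
- move=> d /=.
  rewrite -[X in N X](_ : resolvent_shift A m%:C d - W (resolvent_shift A m%:C d)
    = resolvent_shift A z d);
    first by rewrite WN resolvent_shift_real /complexify /= !UA.
  by rewrite shiftE resolvent_shift_real /= /W0 /= !UA.
- have [x xU xN] := AU (N v).1; have [y yU yN] := AU (N v).2.
  exists (x, y); first by rewrite /complexify /= xU yU.
  by rewrite shiftE resolvent_shift_real /= xN yN /complexify /= xU yU
    -surjective_pairing NW.
split=> //; rewrite resE => v.
apply: (@continuous_comp (X * X)%type (X * X)%type (X * X)%type N);
  first exact: Ncont.
apply: continuous_complexify; apply/bounded_mapP.
exact: (positive_linear_bounded HK Kgen Knormal UK).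
Qed.

Hypothesis Apos : resolvent_positive A K.

Lemma large_positive_resolvent (a : R) : exists l T,
  a < l /\ positive_resolvent_at l T.
Proof.
have [om omP] := Apos.
pose l := `|a| + `|om| + 1.
have al : a < l by rewrite /l; have := ler_norm a; have := normr_ge0 om; lra.
have oml : om < l by rewrite /l; have := ler_norm om; have := normr_ge0 a; lra.
have [rs pos] := omP l oml; have [T [rT _ TE]] := complex_real_resolvent rs.
exists l, T; split=> //; split=> // x Kx; rewrite TE.
have [|u + ->] := pos x; first by rewrite /cone_le subr0.
by rewrite /cone_le subr0.
Qed.

(** Every [z = x + i y] with [x > l] lies in the disc of center [m] and radius
    [m - l] for all large [m]. *)
Lemma complex_resolvent_half_plane (l : R) (T : {linear X -> X}) (z : R[i]) :
  positive_resolvent_at l T -> l < complex.Re z -> resolvent_set A z.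
Proof.
move=> pT lz; case: z lz => x y /= lx.
(* [`|m - z|^2 < (m - l)^2] simplifies to [b < m]. *)
pose b := (x ^+ 2 + y ^+ 2 - l ^+ 2) / (2 * (x - l)).
have [m [U [bm pU]]] := large_positive_resolvent (Num.max b l).
move: bm; rewrite gt_max => /andP[bm lm].
apply: (complex_resolvent_disc pT pU lm).
rewrite normc_def ltcR /= -[ltRHS]gtr0_norm ?subr_gt0// -sqrtr_sqr.
rewrite ltr_sqrt; last by rewrite exprn_gt0// subr_gt0.
move: bm; rewrite /b ltr_pdivrMr ?mulr_gt0 ?subr_gt0// => bm.
by rewrite sub0r sqrrN; nra.
Qed.

(** Let [s] be the infimum of the points [l >= t] with a positive resolvent. The
    resolvent at [s], whose positivity is not yet known, is bounded by some [L].
    By the resolvent identity the positive resolvents at points close enough to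
    [s] are bounded by [2 L], so from such a point one can step down beyond [s],
    unless [t] is reached. *)
Lemma positive_resolvent_of_ray (t : R) :
  (forall l, t <= l -> resolvent_set A l%:C) ->
  exists T, positive_resolvent_at t T.
Proof.
move=> ray.
pose E : set R := [set l | t <= l /\ exists T, positive_resolvent_at l T].
have E0 : E !=set0.
  by have [l [T [tl pT]]] := large_positive_resolvent t; exists l;
    split; [exact: ltW|exists T].
have Elb : lbound E t by move=> l [].
pose s := inf E.
have ts : t <= s by exact: lb_le_inf.
have [Ts [rTs [L0 TL0] _]] := complex_real_resolvent (ray s ts).
pose L := `|L0| + 1.
have L_gt0 : 0 < L by rewrite ltr_wpDl.
have TL x : `|Ts x| <= L * `|x|.
  apply: le_trans (TL0 x) _; rewrite ler_wpM2r//.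
  by rewrite (le_trans (ler_norm _))// lerDl.
have [l [tl [T pT]] ls] : exists2 l, E l & l < s + (4 * L)^-1.
  by apply: inf_adherent; [rewrite invr_gt0 mulr_gt0|split=> //; exists t].
have sl : s <= l by apply: ge_inf; [exists t|split=> //; exists T].
have T2L x : `|T x| <= 2 * L * `|x|.
  have := resolvent_identity rTs pT.1 x.
  move=> /(congr1 Num.norm); have := ler_normD (Ts x) ((s - l) *: Ts (T x)).
  rewrite normrZ distrC ger0_norm ?subr_ge0// => h1 h2; rewrite -h2 {h2} in h1.
  have h3 : (l - s) * `|Ts (T x)| <= 4^-1 * `|T x|.
    apply: (@le_trans _ _ ((l - s) * (L * `|T x|))).
      by rewrite ler_wpM2l// subr_ge0.
    rewrite mulrA ler_wpM2r// -ler_pdivlMr// -invfM.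
    by rewrite lerBlDl ltW.
  have := TL x; have := normr_ge0 (Ts x); have := normr_ge0 x; nra.
pose u := Num.max t (s - (8 * L)^-1).
have L8 : 0 < (8 * L)^-1 by rewrite invr_gt0 mulr_gt0.
have ul : u <= l by rewrite ge_max tl/=; apply: le_trans sl; rewrite gerBl ltW.
(* As [s <= l < s + (4 L)^-1], the step [l - u] is at most
   [(4 L)^-1 + (8 L)^-1], which is less than the admissible [(2 L)^-1]. *)
have [|||U] := @resolvent_step l T (2 * L) (l - u) pT T2L.
- by rewrite mulr_ge0// ltW.
- by rewrite subr_ge0.
- have : s - (8 * L)^-1 <= u by rewrite le_max lexx orbT.
  have -> : (8 * L)^-1 = (4 * L)^-1 / 2 by field; rewrite gt_eqF.
  move=> h; rewrite -ltr_pdivlMr ?mulr_gt0//.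
  have -> : (2 * L)^-1 = 2 * (4 * L)^-1 by field; rewrite gt_eqF.
  have : 0 < (4 * L)^-1 by rewrite invr_gt0 mulr_gt0.
  by lra.
rewrite subKr => pU; exists U.
have su : s <= u.
  by apply: ge_inf; [exists t|split; [rewrite le_max lexx|exists U]].
suff <- : u = t by [].
move: su; rewrite /u le_max => /orP[st|]; last by lra.
by apply: max_l; lra.
Qed.

End PositiveResolvent.

(** * The conditions on positive vectors *)

Section Equivalences.
Variables (R : realType) (X : completeNormedModType R) (K : set X).
Hypotheses (HK : ordering_cone K) (Kgen : generating K).
Hypothesis Knormal : normal_cone K.
Variables (S : pred X) (D : subLmodType S) (A : {linear D -> X}).

Lemma op_norm_le (P : X -> X) (e : R) :
  (op_norm P <= e%:E)%E <-> forall x, `|x| <= 1 -> `|P x| <= e.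
Proof.
split=> [Pe x x1|Pe]; last first.
  by apply: ge_ereal_sup => _ [x /= x1 <-]; rewrite lee_fin; exact: Pe.
rewrite -lee_fin; apply: le_trans Pe; apply: ereal_sup_ubound.
by exists x.
Qed.

Lemma le_op_norm (P : {linear X -> X}) (e : R) (x : X) :
  (op_norm P <= e%:E)%E -> `|P x| <= e * `|x|.
Proof.
move=> /op_norm_le Pe; have [->|x0] := eqVneq x 0.
  by rewrite linear0 !normr0 mulr0.
have nx : 0 < `|x| by rewrite normr_gt0.
have := Pe (`|x|^-1 *: x); rewrite linearZ /= !normrZ normfV.
rewrite normr_id mulVf ?gt_eqF//.
by rewrite mulrC ler_pdivrMr//; exact.
Qed.

Lemma op_inv_image (x : D) : injective A -> op_inv A (A x) = val x.
Proof.
move=> inj; rewrite /op_inv; case: xgetP => [u _ [x' /= /inj-> <-]|nx] //.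
by exfalso; apply: (nx (val x)); exists x.
Qed.

Lemma resolvent_at0 (T : {linear X -> X}) : is_resolvent A 0 T ->
  bijective A /\ forall y, T y = - op_inv A y.
Proof.
move=> [TA AT]; have inj : injective A.
  move=> x x' xx'; apply: val_inj.
  by have := TA x; have := TA x'; rewrite !scale0r xx' => ->.
split; last first.
  move=> y; have [x xT xy] := AT y.
  by rewrite -xT -xy scale0r sub0r -linearN op_inv_image// linearN opprK.
rewrite -setTT_bijective; split=> [//|x x' _ _|y _]; first exact: inj.
have [x _ xy] := AT y; exists (- x) => //.
by rewrite linearN -xy scale0r sub0r.
Qed.

(** Assertion (ii) says that 0 is a point with a positive resolvent; boundedness
    of the inverse is automatic. *)
Lemma positive_inverseP :
  bijective A /\ positive_map K (fun y => - op_inv A y) <->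
  exists T, positive_resolvent_at K A 0 T.
Proof.
split=> [[bA pA]|[T [rT TK]]]; last first.
  have [bA TE] := resolvent_at0 rT.
  by split=> // y; rewrite /cone_le !subr0 -TE; exact: TK.
have rT : is_resolvent A 0 (fun y => - op_inv A y).
  split=> [x|y].
    by rewrite scale0r sub0r -linearN op_inv_image ?linearN ?opprK//; exact: bij_inj.
  have [g _ gK] := bA; exists (- g y).
    by rewrite -[in RHS](gK y) op_inv_image ?linearN//; exact: bij_inj.
  by rewrite scale0r sub0r -linearN opprK gK.
pose T : {linear X -> X} := HB.pack (fun y => - op_inv A y)
  (GRing.isLinear.Build _ _ _ _ _ (is_resolvent_linear rT)).
exists T; split=> // x Kx.
by have := pA x; rewrite /cone_le !subr0; exact.
Qed.

(** Applying the positive operator [T = - A^-1] to [- A x <= y] gives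
    [x <= T y]. *)
Lemma dominated_of_positive_resolvent (T : {linear X -> X}) :
  positive_resolvent_at K A 0 T ->
  exists2 c : R, 0 < c & forall (x : D) (y : X),
    K (val x) -> K (y + A x) -> `|val x| <= c * `|y|.
Proof.
move=> [[TA _] TK]; have [C C0 KC] := normality Knormal.
have [L TL] := positive_linear_bounded HK Kgen Knormal TK.
exists (C * (`|L| + 1)); first by rewrite mulr_gt0// ltr_wpDl.
move=> x y Kx Kyx; apply: (@le_trans _ _ (C * `|T y|)).
  apply: KC => //.
  by rewrite -(TA x) scale0r sub0r -linearB opprK; exact: TK.
rewrite -mulrA ler_wpM2l ?(ltW C0)//; apply: le_trans (TL y) _.
by rewrite ler_wpM2r// (le_trans (ler_norm _))// lerDl.
Qed.

Lemma dist_set_ge (x : X) (r : R) :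
  (forall k, K k -> r <= `|x - k|) -> r <= dist_set x K.
Proof.
move=> rK; apply: lb_le_inf; first by exists `|x - 0|, 0 => //; exact: cone_0.
by move=> _ [k Kk <-]; exact: rK.
Qed.

Lemma dist_set_le (x k : X) : K k -> dist_set x K <= `|x - k|.
Proof. by move=> Kk; apply: ge_inf; [exists 0 => _ [y _ <-]|exists k]. Qed.

(** For positive [k], split [k - A x] as [y - z] with [`|y|] at most a multiple
    of [`|A x - k|]; then [- A x <= y]. *)
Lemma dist_of_dominated (c : R) : 0 < c ->
  (forall (x : D) (y : X), K (val x) -> K y -> K (y + A x) ->
     `|val x| <= c * `|y|) ->
  exists2 eta : R, 0 < eta &
    forall x : D, K (val x) -> eta * `|val x| <= dist_set (A x) K.
Proof.
move=> c0 dom; have [M M0 dec] := bounded_decomposition HK Kgen.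
exists (c * M)^-1; first by rewrite invr_gt0 mulr_gt0.
move=> x Kx; apply: dist_set_ge => k Kk; rewrite ler_pdivrMl ?mulr_gt0//.
have [y [z [Ky Kz yz yM _]]] := dec (k - A x).
rewrite distrC -mulrA; apply: le_trans (_ : c * `|y| <= _); last first.
  by rewrite ler_wpM2l// ltW.
apply: dom => //; have -> : y + A x = z + k.
  by rewrite -[y](subrK z) -yz addrAC subrK addrC.
exact: (cone_add HK).
Qed.

(** If [A x + P x] is positive, the distance from [A x] to the cone is at most
    [`|P x|]. *)
Lemma no_positive_subeigenvector (eta : R) : 0 < eta ->
  (forall x : D, K (val x) -> eta * `|val x| <= dist_set (A x) K) ->
  exists2 eps : R, 0 < eps &
    forall (x : D) (P : {linear X -> X}), K (val x) -> val x != 0 ->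
      (op_norm P <= eps%:E)%E -> ~ K (A x + P (val x)).
Proof.
move=> eta0 dist; exists (eta / 2); first by rewrite divr_gt0.
move=> x P Kx x0 Pe KAP; have := le_trans (dist x Kx) (dist_set_le (A x) KAP).
rewrite opprD addrA subrr add0r normrN => h.
have := le_trans h (le_op_norm (val x) Pe).
rewrite ler_pM2r ?normr_gt0//; lra.
Qed.

(** If [x = R(l) y] is much larger than the positive vector [y], the operator
    [P z = (f z / f x) y], for a positive [f] that nearly norms [x], has small
    norm, and [A x + P x = l x - y + y >= 0]. *)
Lemma resolvent_bound_of_rank1 (eps : R) : 0 < eps ->
  (forall (x : D) (P : {linear X -> X}), K (val x) -> val x != 0 ->
     (forall y, K y -> K (P y)) -> (op_norm P <= eps%:E)%E -> rank1 P ->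
     ~ K (A x + P (val x))) ->
  exists2 L : R, 0 < L & forall l T, 0 <= l -> positive_resolvent_at K A l T ->
    forall y, `|T y| <= L * `|y|.
Proof.
move=> e0 noP; have [C C0 func] := positive_norming_functional HK Knormal.
have [M M0 bc] := bounded_on_cone HK Kgen.
exists (M * (C / eps)); first by rewrite mulr_gt0// divr_gt0.
move=> l T l0 [rT TK]; apply: bc => [|y Ky]; first by rewrite divr_ge0// ltW.
rewrite leNgt; apply/negP => Ty.
have [x xT xy] := rT.2 y.
have Kx : K (val x) by rewrite xT; exact: TK.
have x_gt0 : 0 < `|val x|.
  by rewrite xT; apply: le_lt_trans Ty; rewrite mulr_ge0// divr_ge0// ltW.
have x_neq0 : val x != 0 by rewrite -normr_gt0.
have y_neq0 : y != 0.
  by apply: contra_ltN Ty => /eqP->; rewrite linear0 !normr0 mulr0.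
have [f [fpos fle fx]] := func _ Kx.
have fx0 : 0 < f (val x) by rewrite -(pmulr_rgt0 _ C0); exact: lt_le_trans fx.
pose P0 (z : X) : X := (f z / f (val x)) *: y.
have P0lin : linear P0.
  move=> a u v; rewrite /P0 linearP /= mulrDl scalerDl scalerA.
  by rewrite -[a *: f u]/(a * f u) mulrA.
pose P : {linear X -> X} := HB.pack P0 (GRing.isLinear.Build _ _ _ _ _ P0lin).
apply: (noP x P) => //.
- move=> z Kz; apply: (cone_scale HK) => //.
  by rewrite divr_ge0 ?fpos// ltW.
- apply/op_norm_le => z z1; rewrite /= /P0 normrZ normrM normfV.
  rewrite (gtr0_norm fx0) mulrAC ler_pdivrMr//.
  apply: (@le_trans _ _ `|y|).
    by rewrite ler_piMl// (le_trans (fle z)).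
  rewrite -xT in Ty; move: Ty; rewrite mulrAC ltr_pdivrMr// => Ty.
  have : C * `|y| <= C * (eps * f (val x)).
    rewrite mulrCA; apply: le_trans (ltW Ty) _.
    by rewrite mulrC ler_wpM2l// ltW.
  by rewrite ler_pM2l.
- exists y => //; apply/seteqP; split=> [_ [z _ <-]|_ [a _ <-]].
    by exists (f z / f (val x)).
  exists (a *: val x) => //=; rewrite /P0 linearZ /=.
  by rewrite -[a *: f _]/(a * f (val x)) mulfK ?gt_eqF.
- rewrite /= /P0 divff ?gt_eqF// scale1r -xy addrC subrK.
  exact: (cone_scale HK).
Qed.

(** Steps of length [1 / (2 L)] are possible from every nonnegative point, so
    finitely many of them lead below 0. *)
Lemma negative_positive_resolvent (L : R) : resolvent_positive A K -> 0 < L ->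
  (forall l T, 0 <= l -> positive_resolvent_at K A l T ->
    forall y, `|T y| <= L * `|y|) ->
  exists l T, l < 0 /\ positive_resolvent_at K A l T.
Proof.
move=> Apos L0 TL.
have [l0 [T0 [_ pT0]]] := large_positive_resolvent Apos 0.
pose d := (2 * L)^-1; have d0 : 0 < d by rewrite invr_gt0 mulr_gt0.
suff step n l T : positive_resolvent_at K A l T -> l < n%:R * d ->
    exists l T, l < 0 /\ positive_resolvent_at K A l T.
  apply: (step (Num.trunc (l0 / d)).+1 _ _ pT0).
  by rewrite -ltr_pdivrMr//; exact: truncnS_gt.
elim: n l T => [|n IH] l T pT; first by rewrite mul0r => l_lt0; exists l, T.
move=> ln; have [l_ge0|l_lt0] := leP 0 l; last by exists l, T.
have [|||U pU] := resolvent_step HK pT (TL l T l_ge0 pT) (d := d).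
- exact: ltW.
- exact: ltW.
- by rewrite /d invfM -mulrA mulVf ?gt_eqF// mulr1 invf_lt1// ltr1n.
by apply: (IH (l - d) U pU); move: ln; rewrite -natr1 mulrDl mul1r ltrBlDr.
Qed.

(** A real [t] above the real spectrum has a positive resolvent, hence no
    spectral point lies to the right of [t]. *)
Lemma spectral_bounds_eq : resolvent_positive A K ->
  spectral_bound A = real_spectral_bound A.
Proof.
move=> Apos; apply/eqP; rewrite eq_le; apply/andP; split; last first.
  apply: ge_ereal_sup => _ [r /= sr <-]; apply: ereal_sup_ubound.
  by exists r%:C.
apply: ge_ereal_sup => _ [z sz <-]; rewrite leNgt; apply/negP => zr.
have [t] : exists t : R, (real_spectral_bound A < t%:E)%E /\ t < complex.Re z.
  case: (real_spectral_bound A) zr => [b|//|_].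
    by rewrite lte_fin => /midf_lt[bt tz]; eexists;
      split; [rewrite lte_fin; exact: bt|].
  by exists (complex.Re z - 1); split; [rewrite ltNyr|rewrite gtrBl].
move=> [rt tz].
have [T pT] : exists T, positive_resolvent_at K A t T.
  apply: (positive_resolvent_of_ray HK Apos) => l tl.
  apply: contrapT => sl; have : (l%:E <= real_spectral_bound A)%E.
    by apply: ereal_sup_ubound; exists l.
  by apply/negP; rewrite -ltNge; apply: lt_le_trans rt _; rewrite lee_fin.
exact: sz (complex_resolvent_half_plane HK Kgen Knormal Apos pT tz).
Qed.

End Equivalences.

(** * The equivalence *)

Unset Implicit Arguments.
Set Strict Implicit.
Set Printing Implicit Defensive.

Theorem theorem3p1 (R : realType) (X : completeNormedModType R) (K : set X)
    (HK : ordering_cone K) (Kgen : generating K) (Knormal : normal_cone K)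
    (S : pred X) (D : subLmodType S) (A : {linear D -> X})
    (Apos : resolvent_positive A K) :
  let assertion_ii :=
    bijective A /\ positive_map K (fun y => - op_inv A y) in
  [<-> (* i *)
       spectral_bound A = real_spectral_bound A /\
         (real_spectral_bound A < 0)%E;
       (* ii *)
       assertion_ii;
       (* iii *)
       exists2 c : R, 0 < c &
         forall (x : D) (y : X), cone_le K 0 (val x) -> cone_le K 0 y ->
           cone_le K (- A x) y -> `|val x| <= c * `|y|;
       (* iv *)
       exists2 eta : R, 0 < eta &
         forall x : D, cone_le K 0 (val x) -> eta * `|val x| <= dist_set (A x) K;
       (* v *)
       exists2 eps : R, 0 < eps &
         forall (x : D) (P : {linear X -> X}),
           cone_le K 0 (val x) -> val x != 0 ->
           positive_map K P -> (op_norm P <= eps%:E)%E ->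
           ~ cone_le K 0 (A x + P (val x));
       (* vi *)
       exists2 eps : R, 0 < eps &
         forall (x : D) (P : {linear X -> X}),
           cone_le K 0 (val x) -> val x != 0 ->
           positive_map K P -> (op_norm P <= eps%:E)%E -> rank1 P ->
           ~ cone_le K 0 (A x + P (val x))]
  /\ (assertion_ii ->
      resolvent_set A 0 /\
      forall y : X,
        resolvent A 0 (embC y) = embC (- op_inv A y)).
Proof.
have cone_le0 (x : X) : cone_le K 0 x <-> K x by rewrite /cone_le subr0.
move=> assertion_ii.
have ii_zero : assertion_ii -> resolvent_set A 0 /\
    forall y : X, resolvent A 0 (embC y) = embC (- op_inv A y).
  move=> /positive_inverseP[T [rT TK]].
  have [r0 resE] := real_complex_resolvent rT
    (positive_linear_bounded HK Kgen Knormal TK).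
  split=> // y; rewrite (_ : 0 = 0%:C) // resE /complexify /embC /= linear0.
  by rewrite (resolvent_at0 rT).2.
split=> //; split; [|split; [|split; [|split; [|split]]]].
- move=> [_ sneg]; apply/positive_inverseP.
  apply: (positive_resolvent_of_ray HK Apos) => l l0.
  apply: contrapT => sl; have : (l%:E <= real_spectral_bound A)%E.
    by apply: ereal_sup_ubound; exists l.
  by apply/negP; rewrite -ltNge; apply: lt_le_trans sneg _; rewrite lee_fin.
- move=> /positive_inverseP[T pT].
  have [c c0 dom] := dominated_of_positive_resolvent HK Kgen Knormal pT.
  exists c => // x y /cone_le0 Kx /cone_le0 Ky; rewrite /cone_le opprK.
  exact: dom.
- move=> [c c0 dom].
  have [|eta eta0 dist] := @dist_of_dominated _ _ _ HK Kgen _ _ A _ c0.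
    move=> x y /cone_le0 Kx /cone_le0 Ky KyA.
    by apply: dom; rewrite // /cone_le opprK.
  by exists eta => // x /cone_le0; exact: dist.
- move=> [eta eta0 dist].
  have [|eps eps0 noP] := @no_positive_subeigenvector _ _ K _ _ A _ eta0.
    by move=> x /cone_le0; exact: dist.
  by exists eps => // x P /cone_le0 Kx x0 _ Pe /cone_le0; exact: noP.
- by move=> [eps eps0 noP]; exists eps => // x P Kx x0 PK Pe _; exact: noP.
move=> [eps eps0 noP].
have [|L L0 TL] := @resolvent_bound_of_rank1 _ _ _ HK Kgen Knormal _ _ A _ eps0.
  move=> x P /cone_le0 Kx x0 PK Pe P1 /cone_le0; apply: noP => //.
  by move=> y /cone_le0 Ky; apply/cone_le0; exact: PK.
have [l [T [l_lt0 pT]]] := negative_positive_resolvent HK Apos L0 TL.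
have sE := spectral_bounds_eq HK Kgen Knormal Apos.
split=> //; rewrite -sE; apply: (@le_lt_trans _ _ l%:E); last by rewrite lte_fin.
apply: ge_ereal_sup => _ [z /= sz <-]; rewrite lee_fin leNgt; apply/negP => lz.
exact: sz (complex_resolvent_half_plane HK Kgen Knormal Apos pT lz).
Qed.
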